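(* Let $w,c,d,\mathit{ch},b,t\ge 0$ be real numbers with $w\ge c$ and $\mathit{ch}>2w$, and put $z=w-c+d-\mathit{ch}$. If $d>c+\mathit{ch}$, $b<c$ and $t>z+d-b$, then Game 2 has a unique sequential equilibrium $((s_1,s_2),(\beta_1,\beta_2))$, where $s_1,\beta_1$ are LDR's strategy and beliefs and $s_2,\beta_2$ are FLR's strategy and beliefs, namely: $s_1$ plays $init$ with probability $1$ at $\mathcal I_{1,1}$ and $r$ with probability $1$ at $\mathcal I_{1,2}$; $s_2$ plays $collude$ with probability $1$ at $\mathcal I_{2,1}$ and $r$ with probability $1$ at $\mathcal I_{2,2}$; $\beta_1$ assigns probability $1$ to $v_0$ at $\mathcal I_{1,1}$ and probability $1$ to $v_2$ at $\mathcal I_{1,2}$; $\beta_2$ assigns probability $1$ to $v_1$ at $\mathcal I_{2,1}$ and probabilities $0,1,0$ to $v_3,v_4,v_5$ at $\mathcal I_{2,2}$.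
   Context: Conventions. Games are finite two-player extensive-form games with imperfect information. A behavior strategy $s_i$ of player $i$ assigns to each information set of $i$ a probability distribution over the actions available there (independently across information sets); it is completely mixed if all actions get positive probability. A belief system $\beta$ assigns to each information set a probability distribution over its nodes. An assessment is a pair $(s,\beta)$ with $s=(s_1,s_2)$ a profile of behavior strategies. Player $i$'s expected payoff at a node $h$ is $u_i(s;h)=\sum_{\zeta}\Pr[\zeta\mid(s,h)]\,u_i(\zeta)$ (sum over terminal nodes $\zeta$), and at an information set $\mathcal I$ of player $i$ it is $u_i(s;\mathcal I,\beta)=\sum_{h\in\mathcal I}\beta(h)u_i(s;h)$. $(s,\beta)$ is sequentially rational if $u_i(s;\mathcal I,\beta)\ge u_i((s_i',s_{-i});\mathcal I,\beta)$ for every player $i$, every information set $\mathcal I$ of $i$ and every behavior strategy $s_i'$ of $i$. It is consistent if there are completely mixed profiles $s^k\to s$ such that the beliefs $\beta^k$ induced by $s^k$ via Bayes' rule converge to $\beta$. A sequential equilibrium is an assessment that is sequentially rational and consistent. The symbol $\mathit{ch}$ is a single real parameter; action labels such as $f(x), r, other$ are formal symbols. Game 2. Players LDR (utility $u_1$) and FLR (utility $u_2$). At the root $v_0$, LDR chooses $\neg init$ (to a terminal node with payoffs $(w-c,w-c)$) or $init$ (to $v_1$). At $v_1$, FLR chooses $\neg collude$ (to a terminal node with payoffs $(w-c,w-c)$) or $collude$ (to $v_2$). (These two terminal nodes stand for the play of another game, whose equilibrium payoffs are $(w-c,w-c)$.) At $v_2$, LDR chooses $f(x)$ (to $v_3$),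 $r$ (to $v_4$) or $other$ (to $v_5$). Then FLR moves with actions $f(x),r,other$, leading, in this order, from $v_3$ to $v_6,v_7,v_8$; from $v_4$ to $v_9,v_{10},v_{11}$; from $v_5$ to $v_{12},v_{13},v_{14}$ (terminal nodes). Information sets: $\mathcal I_{1,1}=\{v_0\}$, $\mathcal I_{1,2}=\{v_2\}$ for LDR; $\mathcal I_{2,1}=\{v_1\}$, $\mathcal I_{2,2}=\{v_3,v_4,v_5\}$ for FLR. Payoffs $(u_1,u_2)$: $v_6:(w-c,\,w-c)$; $v_7:(z-t-b,\,-d+t+b)$; $v_8:(z,\,-d)$; $v_9:(-d+t,\,z-t)$; $v_{10}:(w-b,\,w+b)$; $v_{11}:(-d+t,\,-d-t)$; $v_{12}:(-d,\,z)$; $v_{13}:(-d-t-b,\,-d+t+b)$; $v_{14}:(-d,\,-d)$. *)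

(* Defs.v *)
From HB Require Import structures.
From mathcomp Require Import all_boot all_order all_algebra.
From mathcomp Require Import all_classical all_reals all_analysis.

Set Implicit Arguments.
Unset Strict Implicit.
Unset Printing Implicit Defensive.

Import Order.TTheory GRing.Theory Num.Theory.
Import numFieldNormedType.Exports.

Local Open Scope classical_set_scope.
Local Open Scope ring_scope.

(** * Probability distributions on a finite type *)

Record dist (R : realType) (A : finType) := Dist {
  dist_fun :> {ffun A -> R};
  distP : [forall a, 0 <= dist_fun a] && (\sum_a dist_fun a == 1) }.

HB.instance Definition _ (R : realType) (A : finType) :=
  [isSub for @dist_fun R A].

Fact point_mass_subproof (R : realType) (A : finType) (a : A) :
  let p := [ffun x => (x == a)%:R : R] in
  [forall x, 0 <= p x] && (\sum_x p x == 1).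
Proof.
apply/andP; split; first by apply/forallP => x; rewrite ffunE ler0n.
rewrite (bigD1 a) //= ffunE eqxx big1 ?addr0 // => x /negPf xa.
by rewrite ffunE xa.
Qed.

Definition point_mass (R : realType) (A : finType) (a : A) : dist R A :=
  Dist (point_mass_subproof R a).

(** * Two-player extensive-form games *)

Inductive player := LDR | FLR.

Definition player_code i := match i with LDR => 0%N | FLR => 1%N end.
Lemma player_codeK : pcancel player_code (onth [:: LDR; FLR]).
Proof. by case. Qed.
HB.instance Definition _ := Countable.copy player (pcan_type player_codeK).
Lemma player_enumP : Finite.axiom [:: LDR; FLR].
Proof. by case. Qed.
HB.instance Definition _ :=
  fintype.isFinite.Build player player_enumP.

Definition edge (D Z : finType) (A : D -> finType)
    (child : forall x : D, A x -> D + Z) : rel (D + Z)%type :=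
  fun u v => if u is inl x then [exists a, child x a == v] else false.

(** The nodes are [decision + terminal].  The actions belong to the information
    sets, so that all nodes of an information set offer the same ones.  The
    last five fields say that [child] is a tree with root [start] and that no
    information set and no action set is empty. *)
Record game (R : realType) := Game {
  decision : finType;
  terminal : finType;
  infoset : player -> finType;
  actions : forall i, infoset i -> finType;
  start : (decision + terminal)%type;
  info : decision -> {i : player & infoset i};
  child : forall x : decision, actions (tagged (info x)) -> decision + terminal;
  payoff : player -> terminal -> R;
  child_inj : injective
    (fun e : {x : decision & actions (tagged (info x))} => child (tagged e));
  child_start : forall x (a : actions (tagged (info x))), child a <> start;
  start_connect : forall v, connect (edge child) start v;
  infoset_neq0 : forall i (I : infoset i),
    exists x, info x = Tagged (fun i => infoset i) I;
  actions_neq0 : forall i (I : infoset i), (0 < #|actions I|)%N }.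

Section Assessments.
Variables (R : realType) (G : game R).

Definition node := (decision G + terminal G)%type.

Definition node_in i (I : infoset G i) : finType :=
  {x : decision G | info x == Tagged (fun i => infoset G i) I}.

Definition strategy (i : player) := forall I : infoset G i, dist R (actions I).
Definition profile := forall i, strategy i.

Definition beliefs (i : player) := forall I : infoset G i, dist R (node_in I).
Definition belief_system := forall i, beliefs i.

Definition assessment := (profile * belief_system)%type.

Definition completely_mixed (s : profile) :=
  forall i (I : infoset G i) (a : actions I), 0 < s i I a.

Fixpoint reach_within (n : nat) (s : profile) (h v : node) : R :=
  if h == v then 1 else
  match n, h with
  | n'.+1, inl x =>
      \sum_(a : actions (tagged (info x)))
         s (tag (info x)) (tagged (info x)) a * reach_within n' s (child a) v
  | _, _ => 0
  end.

(** A path in the tree leaves each decision node at most once, so the bound on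
    its length is no restriction. *)
Definition reach (s : profile) (h v : node) : R :=
  reach_within #|decision G| s h v.

Definition node_payoff (i : player) (s : profile) (h : node) : R :=
  \sum_(z : terminal G) reach s h (inr z) * payoff i z.

Definition infoset_payoff (i : player) (s : profile) (I : infoset G i)
    (b : belief_system) : R :=
  \sum_(x : node_in I) b i I x * node_payoff i s (inl (val x)).

Definition deviate (s : profile) i (si : strategy i) : profile :=
  eqtype.dfwith s si.

Definition sequentially_rational (a : assessment) :=
  forall i (I : infoset G i) (si : strategy i),
    infoset_payoff (deviate a.1 si) I a.2 <= infoset_payoff a.1 I a.2.

Definition bayes (s : profile) i (I : infoset G i) (x : node_in I) : R :=
  reach s (start G) (inl (val x)) /
  \sum_(y : node_in I) reach s (start G) (inl (val y)).

Definition consistent (a : assessment) :=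
  exists s_ : nat -> profile,
    [/\ forall k, completely_mixed (s_ k),
        forall i (I : infoset G i) (e : actions I),
          (fun k => s_ k i I e) @ \oo --> a.1 i I e
      & forall i (I : infoset G i) (x : node_in I),
          (fun k => bayes (s_ k) x) @ \oo --> a.2 i I x].

Definition sequential_equilibrium (a : assessment) :=
  sequentially_rational a /\ consistent a.

End Assessments.

(** * Game 2 *)

Inductive ldr_infoset := I11 | I12.
Inductive flr_infoset := I21 | I22.
Inductive initiation := Init | NotInit.
Inductive collusion := Collude | NotCollude.
Inductive answer := AnsF | AnsR | AnsOther. (* f(x), r, other *)
Inductive decision2 := v0 | v1 | v2 | v3 | v4 | v5.
Inductive terminal2 := endNotInit | endNotCollude
  | v6 | v7 | v8 | v9 | v10 | v11 | v12 | v13 | v14.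

Definition ldr_infoset_code I := match I with I11 => 0%N | I12 => 1%N end.
Lemma ldr_infoset_codeK : pcancel ldr_infoset_code (onth [:: I11; I12]).
Proof. by case. Qed.
HB.instance Definition _ :=
  Countable.copy ldr_infoset (pcan_type ldr_infoset_codeK).
Lemma ldr_infoset_enumP : Finite.axiom [:: I11; I12].
Proof. by case. Qed.
HB.instance Definition _ :=
  fintype.isFinite.Build ldr_infoset ldr_infoset_enumP.

Definition flr_infoset_code I := match I with I21 => 0%N | I22 => 1%N end.
Lemma flr_infoset_codeK : pcancel flr_infoset_code (onth [:: I21; I22]).
Proof. by case. Qed.
HB.instance Definition _ :=
  Countable.copy flr_infoset (pcan_type flr_infoset_codeK).
Lemma flr_infoset_enumP : Finite.axiom [:: I21; I22].
Proof. by case. Qed.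
HB.instance Definition _ :=
  fintype.isFinite.Build flr_infoset flr_infoset_enumP.

Definition initiation_code a := match a with Init => 0%N | NotInit => 1%N end.
Lemma initiation_codeK : pcancel initiation_code (onth [:: Init; NotInit]).
Proof. by case. Qed.
HB.instance Definition _ :=
  Countable.copy initiation (pcan_type initiation_codeK).
Lemma initiation_enumP : Finite.axiom [:: Init; NotInit].
Proof. by case. Qed.
HB.instance Definition _ :=
  fintype.isFinite.Build initiation initiation_enumP.

Definition collusion_code a :=
  match a with Collude => 0%N | NotCollude => 1%N end.
Lemma collusion_codeK : pcancel collusion_code (onth [:: Collude; NotCollude]).
Proof. by case. Qed.
HB.instance Definition _ :=
  Countable.copy collusion (pcan_type collusion_codeK).
Lemma collusion_enumP : Finite.axiom [:: Collude; NotCollude].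
Proof. by case. Qed.
HB.instance Definition _ :=
  fintype.isFinite.Build collusion collusion_enumP.

Definition answer_code a :=
  match a with AnsF => 0%N | AnsR => 1%N | AnsOther => 2%N end.
Lemma answer_codeK : pcancel answer_code (onth [:: AnsF; AnsR; AnsOther]).
Proof. by case. Qed.
HB.instance Definition _ := Countable.copy answer (pcan_type answer_codeK).
Lemma answer_enumP : Finite.axiom [:: AnsF; AnsR; AnsOther].
Proof. by case. Qed.
HB.instance Definition _ :=
  fintype.isFinite.Build answer answer_enumP.

Definition decision2_code x :=
  match x with
  | v0 => 0%N | v1 => 1%N | v2 => 2%N | v3 => 3%N | v4 => 4%N | v5 => 5%N
  end.
Lemma decision2_codeK :
  pcancel decision2_code (onth [:: v0; v1; v2; v3; v4; v5]).
Proof. by case. Qed.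
HB.instance Definition _ :=
  Countable.copy decision2 (pcan_type decision2_codeK).
Lemma decision2_enumP : Finite.axiom [:: v0; v1; v2; v3; v4; v5].
Proof. by case. Qed.
HB.instance Definition _ :=
  fintype.isFinite.Build decision2 decision2_enumP.

Definition terminal2_code x :=
  match x with
  | endNotInit => 0%N | endNotCollude => 1%N
  | v6 => 2%N | v7 => 3%N | v8 => 4%N
  | v9 => 5%N | v10 => 6%N | v11 => 7%N
  | v12 => 8%N | v13 => 9%N | v14 => 10%N
  end.
Lemma terminal2_codeK : pcancel terminal2_code
  (onth [:: endNotInit; endNotCollude;
            v6; v7; v8; v9; v10; v11; v12; v13; v14]).
Proof. by case. Qed.
HB.instance Definition _ :=
  Countable.copy terminal2 (pcan_type terminal2_codeK).
Lemma terminal2_enumP : Finite.axiom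
  [:: endNotInit; endNotCollude; v6; v7; v8; v9; v10; v11; v12; v13; v14].
Proof. by case. Qed.
HB.instance Definition _ :=
  fintype.isFinite.Build terminal2 terminal2_enumP.

Definition infoset2 (i : player) : finType :=
  match i with LDR => ldr_infoset | FLR => flr_infoset end.

Definition actions2 (i : player) : infoset2 i -> finType :=
  match i return infoset2 i -> finType with
  | LDR => fun I : ldr_infoset =>
      match I with I11 => initiation | I12 => answer end
  | FLR => fun I : flr_infoset =>
      match I with I21 => collusion | I22 => answer end
  end.

Definition info2 (x : decision2) : {i : player & infoset2 i} :=
  match x with
  | v0 => existT (fun i => infoset2 i : Type) LDR I11
  | v1 => existT (fun i => infoset2 i : Type) FLR I21
  | v2 => existT (fun i => infoset2 i : Type) LDR I12
  | v3 | v4 | v5 => existT (fun i => infoset2 i : Type) FLR I22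
  end.

Definition child2 (x : decision2) :
    actions2 (tagged (info2 x)) -> decision2 + terminal2 :=
  match x return actions2 (tagged (info2 x)) -> decision2 + terminal2 with
  | v0 => fun a : initiation =>
      match a with Init => inl v1 | NotInit => inr endNotInit end
  | v1 => fun a : collusion =>
      match a with Collude => inl v2 | NotCollude => inr endNotCollude end
  | v2 => fun a : answer =>
      match a with AnsF => inl v3 | AnsR => inl v4 | AnsOther => inl v5 end
  | v3 => fun a : answer =>
      match a with AnsF => inr v6 | AnsR => inr v7 | AnsOther => inr v8 end
  | v4 => fun a : answer =>
      match a with AnsF => inr v9 | AnsR => inr v10 | AnsOther => inr v11 end
  | v5 => fun a : answer =>
      match a with AnsF => inr v12 | AnsR => inr v13 | AnsOther => inr v14 end
  end.

Definition payoffs2 (R : realType) (w c d b t z : R) (x : terminal2) : R * R :=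
  match x with
  | endNotInit    => (w - c, w - c)
  | endNotCollude => (w - c, w - c)
  | v6  => (w - c, w - c)
  | v7  => (z - t - b, - d + t + b)
  | v8  => (z, - d)
  | v9  => (- d + t, z - t)
  | v10 => (w - b, w + b)
  | v11 => (- d + t, - d - t)
  | v12 => (- d, z)
  | v13 => (- d - t - b, - d + t + b)
  | v14 => (- d, - d)
  end.

Definition payoff2 (R : realType) (w c d b t z : R) (i : player)
    (x : terminal2) : R :=
  match i with
  | LDR => (payoffs2 w c d b t z x).1
  | FLR => (payoffs2 w c d b t z x).2
  end.

Lemma child2_inj : injective
  (fun e : {x : decision2 & actions2 (tagged (info2 x))} => child2 (tagged e)).
Proof.
by move=> [x a] [y b]; case: x a => -[]; case: y b => -[].
Qed.

Lemma child2_start x (a : actions2 (tagged (info2 x))) : child2 a <> inl v0.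
Proof. by case: x a => -[]. Qed.

Lemma start2_connect v : connect (edge child2) (inl v0) v.
Proof.
have step x (a : actions2 (tagged (info2 x))) :
    connect (edge child2) (inl v0) (inl x) ->
    connect (edge child2) (inl v0) (child2 a).
  move=> h; apply: connect_trans h (connect1 _).
  by apply/existsP; exists a.
have h0 : connect (edge child2) (inl v0) (inl v0) by [].
have h1 := step v0 Init h0.
have h2 := step v1 Collude h1.
have h3 := step v2 AnsF h2.
have h4 := step v2 AnsR h2.
have h5 := step v2 AnsOther h2.
case: v => -[] //.
- exact: (step v0 NotInit).
- exact: (step v1 NotCollude).
- exact: (step v3 AnsF).
- exact: (step v3 AnsR).
- exact: (step v3 AnsOther).
- exact: (step v4 AnsF).
- exact: (step v4 AnsR).
- exact: (step v4 AnsOther).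
- exact: (step v5 AnsF).
- exact: (step v5 AnsR).
- exact: (step v5 AnsOther).
Qed.

Lemma infoset2_neq0 i (I : infoset2 i) :
  exists x, info2 x = Tagged (fun i => infoset2 i) I.
Proof.
by case: i I => -[]; [exists v0 | exists v2 | exists v1 | exists v3].
Qed.

Lemma actions2_neq0 i (I : infoset2 i) : (0 < #|actions2 I|)%N.
Proof.
apply/card_gt0P.
by case: i I => -[]; [exists Init | exists AnsR | exists Collude | exists AnsR].
Qed.

Definition game2 (R : realType) (w c d b t z : R) : game R :=
  @Game R decision2 terminal2 infoset2 actions2 (inl v0) info2 child2
    (payoff2 w c d b t z)
    child2_inj child2_start start2_connect infoset2_neq0 actions2_neq0.

Section CollusionAssessment.
Variables (R : realType) (w c d b t z : R).
Let G := game2 w c d b t z.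

Definition collusion_profile : profile G := fun i =>
  match i return strategy G i with
  | LDR => fun I : ldr_infoset =>
      match I return dist R (@actions2 LDR I) with
      | I11 => point_mass R Init
      | I12 => point_mass R AnsR
      end
  | FLR => fun I : flr_infoset =>
      match I return dist R (@actions2 FLR I) with
      | I21 => point_mass R Collude
      | I22 => point_mass R AnsR
      end
  end.

Definition node_of i (I : infoset2 i) (x : decision2)
    (h : info2 x == Tagged (fun i => infoset2 i) I) : @node_in R G i I :=
  exist _ x h.

Definition collusion_beliefs : belief_system G := fun i =>
  match i return beliefs G i with
  | LDR => fun I : ldr_infoset =>
      match I return dist R (@node_in R G LDR I) with
      | I11 => point_mass R (@node_of LDR I11 v0 (eqxx _))
      | I12 => point_mass R (@node_of LDR I12 v2 (eqxx _))
      end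
  | FLR => fun I : flr_infoset =>
      match I return dist R (@node_in R G FLR I) with
      | I21 => point_mass R (@node_of FLR I21 v1 (eqxx _))
      | I22 => point_mass R (@node_of FLR I22 v4 (eqxx _))
      end
  end.

Definition collusion_assessment : assessment G :=
  (collusion_profile, collusion_beliefs).

End CollusionAssessment.

Arguments collusion_profile {R} w c d b t z.
Arguments collusion_beliefs {R} w c d b t z.

(* Main.v *)
(** Answering [r] is strictly dominant for FLR in each node of the last
    information set, whatever the beliefs.  Knowing this, LDR strictly prefers
    [r] at [v2], so collusion is worth [w + b] to FLR and [w - b] to LDR, both
    more than [w - c]; this settles [v1] and then [v0].  Each step of this
    backward induction uses only the deviation of a player to the whole
    collusive strategy, as the later choices are known to be collusive already.
    The belief in the last information set is determined by consistency: for a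
    completely mixed profile, Bayes' rule yields LDR's mixture at [v2]. *)

Require Import Defs.
From mathcomp Require Import all_boot all_order all_algebra.
From mathcomp Require Import all_classical all_reals all_analysis.
From mathcomp Require Import lra.

Import Order.TTheory GRing.Theory Num.Theory.
Import numFieldNormedType.Exports.
Local Open Scope classical_set_scope.
Local Open Scope ring_scope.

(** * Averages over a finite distribution and their maximizers *)

Section Distributions.
Context {R : realType} {A : finType}.
Implicit Types (p : dist R A) (f g : A -> R) (a : A).

Lemma dist_ge0 p a : 0 <= p a.
Proof. by case: p => q /= /andP[/forallP]. Qed.

Lemma sum_dist p : \sum_a p a = 1.
Proof. by case: p => q /= /andP[_ /eqP]. Qed.

Lemma dist_eqP p (q : dist R A) : (forall a, p a = q a) -> p = q.
Proof. by move=> pq; apply/val_inj/ffunP. Qed.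

Lemma point_massE a x : point_mass R a x = (x == a)%:R.
Proof. by rewrite /point_mass /= ffunE. Qed.

Lemma sum_point_mass a f : \sum_x point_mass R a x * f x = f a.
Proof.
rewrite (bigD1 a) //= point_massE eqxx mul1r big1 ?addr0 // => x /negPf xa.
by rewrite point_massE xa mul0r.
Qed.

Lemma dist_point_mass p a : p a = 1 -> p = point_mass R a.
Proof.
move=> pa; apply: dist_eqP => x; rewrite point_massE.
case: eqVneq => [-> //|xa].
have := sum_dist p; rewrite (bigD1 a) //= pa => /(canRL (addKr _)).
rewrite addNr => /eqP; rewrite psumr_eq0; last by move=> *; apply: dist_ge0.
by move=> /allP/(_ x); rewrite mem_index_enum xa => /(_ isT)/eqP.
Qed.

Lemma dist_singleton p a : (forall x, x = a) -> p = point_mass R a.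
Proof.
move=> all_a; apply: dist_point_mass; rewrite -(sum_dist p) (bigD1 a) //=.
by rewrite big1 ?addr0 // => x; rewrite (all_a x) eqxx.
Qed.

Lemma sum_dist_le p f m : (forall a, f a <= m) -> \sum_a p a * f a <= m.
Proof.
move=> fm; rewrite -[leRHS]mul1r -(sum_dist p) mulr_suml.
by apply: ler_sum => a _; rewrite ler_wpM2l ?dist_ge0.
Qed.

(** Strictness comes from a point of positive mass, which exists because the masses sum to 1. *)
Lemma sum_dist_lt p f g :
  (forall a, f a < g a) -> \sum_a p a * f a < \sum_a p a * g a.
Proof.
move=> fg; have [[a0 pa0]|p0] := pselect (exists a, 0 < p a).
  rewrite (bigD1 a0) //= [ltRHS](bigD1 a0) //=.
  apply: ltr_leD; first by rewrite ltr_pM2l.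
  by apply: ler_sum => x _; rewrite ler_wpM2l ?dist_ge0 ?ltW.
have := sum_dist p; rewrite big1 => [/esym/eqP|a _]; first by rewrite oner_eq0.
apply: le_anti; rewrite dist_ge0 andbT leNgt; apply/negP => pa.
by apply: p0; exists a.
Qed.

(** The gaps [f a - f x], weighted by [p], are nonnegative and sum to at most 0, so each product
    vanishes; as the gap is strict for [x != a], [p x] is 0 there. *)
Lemma dist_argmax p f a : (forall x, x != a -> f x < f a) ->
  f a <= \sum_x p x * f x -> p = point_mass R a.
Proof.
move=> fa le_fa; apply: dist_point_mass.
have : \sum_x p x * (f a - f x) <= 0.
  under eq_bigr do rewrite mulrBr.
  by rewrite big_split /= sumrN -mulr_suml sum_dist mul1r subr_le0.
have ge0 x : true -> 0 <= p x * (f a - f x).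
  move=> _; case: (eqVneq x a) => [->|xa]; first by rewrite subrr mulr0.
  by rewrite mulr_ge0 ?dist_ge0// subr_ge0 ltW// fa.
move=> le0; have /eqP : \sum_x p x * (f a - f x) = 0.
  by apply: le_anti; rewrite le0 sumr_ge0.
rewrite psumr_eq0 // => /allP eq0; rewrite -(sum_dist p) (bigD1 a) //=.
rewrite big1 ?addr0 // => x xa.
have /implyP/(_ isT) := eq0 x (mem_index_enum _).
by rewrite mulf_eq0 subr_eq0 (gt_eqF (fa _ xa)) orbF => /eqP.
Qed.

End Distributions.

(** * One-step recursion for payoffs in a general game *)

Section Games.
Context {R : realType} {G : game R}.
Implicit Types (s : profile G) (i : player) (h v : node G).

(** [node_payoff] with the bound of [reach_within] left free, for induction on that bound. *)
Definition payoff_within n i s h : R :=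
  \sum_z reach_within n s h (inr z) * payoff i z.

Lemma payoff_within_terminal n i s z : payoff_within n i s (inr z) = payoff i z.
Proof.
rewrite /payoff_within (bigD1 z) //= big1 => [|y /negPf yz].
  by case: n => [|n] /=; rewrite eqxx mul1r addr0.
have zy : (inr z == inr y :> node G) = false by rewrite eq_sym; apply: yz.
by case: n => [|n] /=; rewrite zy mul0r.
Qed.

Lemma payoff_within_decision n i s x :
  payoff_within n.+1 i s (inl x) =
  \sum_(a : actions (tagged (info x)))
    s _ (tagged (info x)) a * payoff_within n i s (child a).
Proof.
rewrite /payoff_within /=; under eq_bigr do rewrite mulr_suml.
rewrite exchange_big; apply: eq_bigr => a _; rewrite mulr_sumr.
by apply: eq_bigr => z _; rewrite mulrA.
Qed.

Variable rank : decision G -> nat.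
Hypothesis rank_child : forall x (a : actions (tagged (info x))) y,
  child a = inl y -> (rank y < rank x)%N.
Hypothesis rank_lt : forall x, (rank x < #|decision G|)%N.

(** Every move lowers the rank, so play from [x] ends within [rank x + 1] moves and all bounds from
    there on agree. *)
Lemma payoff_within_rank i s n m x : (rank x < n)%N -> (rank x < m)%N ->
  payoff_within n i s (inl x) = payoff_within m i s (inl x).
Proof.
elim: n m x => // n IHn [//|m] x xn xm.
rewrite !payoff_within_decision; apply: eq_bigr => a _; congr (_ * _).
case ca: (child a) => [y|z]; last by rewrite !payoff_within_terminal.
have yx := rank_child _ _ _ ca.
by apply: IHn; apply: leq_trans yx _.
Qed.

Lemma node_payoff_terminal i s z : node_payoff i s (inr z) = payoff i z.
Proof. exact: payoff_within_terminal. Qed.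

Lemma node_payoff_decision i s x : node_payoff i s (inl x) =
  \sum_(a : actions (tagged (info x)))
    s _ (tagged (info x)) a * node_payoff i s (child a).
Proof.
(* Unfolding a move uses up one unit of the bound; raising it beforehand leaves exactly
   [#|decision G|] for the children. *)
have -> : node_payoff i s (inl x) = payoff_within #|decision G|.+1 i s (inl x).
  exact: (payoff_within_rank _ _ _ _ _ (rank_lt x) (leqW (rank_lt x))).
exact: payoff_within_decision.
Qed.

End Games.

(** * Completely mixed profiles converging to a given one *)

Section Perturbation.
Context {R : realType} {G : game R}.

(** A mixture of [p] with the uniform distribution, whose weight 1/(k+1) is positive, at most 1 and
    tends to 0. *)
Lemma perturbation_subproof k {A : finType} (p : dist R A) (A0 : (0 < #|A|)%N) :
  let q := [ffun a => (1 - harmonic k) * p a + harmonic k / #|A|%:R] in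
  [forall a, 0 <= q a] && (\sum_a q a == 1).
Proof.
have k0 : 0 <= 1 - harmonic k :> R.
  by rewrite subr_ge0 invf_le1 ?ltr0n // ler1n.
apply/andP; split.
  apply/forallP => a; rewrite ffunE.
  by rewrite addr_ge0 ?divr_ge0 ?harmonic_ge0// mulr_ge0 ?dist_ge0.
under eq_bigr do rewrite ffunE.
rewrite big_split /= -mulr_sumr sum_dist mulr1 sumr_const.
rewrite -[_ / _ *+ _]mulr_natr divfK ?subrK// pnatr_eq0.
by case: #|A| A0.
Qed.

Definition perturbation (s : profile G) k : profile G := fun i I =>
  Dist (perturbation_subproof k (s i I) (actions_neq0 I)).

Lemma perturbation_mixed s k : completely_mixed (perturbation s k).
Proof.
move=> i I a; rewrite /= ffunE ltr_wpDl ?mulr_ge0 ?dist_ge0//.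
  by rewrite subr_ge0 invf_le1 ?ltr0n // ler1n.
by rewrite divr_gt0 ?ltr0n ?actions_neq0.
Qed.

Lemma perturbation_cvg s i (I : infoset G i) (a : actions I) :
  (fun k => perturbation s k i I a) @ \oo --> s i I a.
Proof.
rewrite (_ : (fun k => _) = (fun k =>
    (1 - harmonic k) * s i I a + harmonic k / #|actions I|%:R)); last first.
  by apply/funext => k /=; rewrite ffunE.
rewrite [X in _ --> X](_ : _ = (1 - 0) * s i I a + 0 / #|actions I|%:R).
  apply: cvgD; apply: cvgMr_tmp; last exact: cvg_harmonic.
  by apply: cvgB; [exact: cvg_cst|exact: cvg_harmonic].
by rewrite subr0 mul1r mul0r addr0.
Qed.

End Perturbation.

(** * Deviations and one-node information sets *)

Lemma deviate_in {R : realType} {G : game R} (s : profile G) {i}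
    (si : strategy G i) : @deviate R G s i si i = si.
Proof. exact: dfwith_in. Qed.

Lemma deviate_out {R : realType} {G : game R} (s : profile G) {i j}
    (si : strategy G i) : i != j -> @deviate R G s i si j = s j.
Proof. exact: dfwith_out. Qed.

(** On a single node the only belief is the point mass, so [b] drops out. *)
Lemma infoset_payoff_singleton {R : realType} {G : game R} (s : profile G) i
    (I : infoset G i) (b : belief_system G) (x : node_in I) :
  (forall y, y = x) -> infoset_payoff s I b = node_payoff i s (inl (val x)).
Proof.
move=> eqx; rewrite /infoset_payoff (dist_singleton (b i I) x eqx).
exact: (sum_point_mass x (fun y => node_payoff i s (inl (val y)))).
Qed.

(** Numerator and denominator coincide; they must not vanish, since division by 0 yields 0. *)
Lemma bayes_singleton {R : realType} {G : game R} (s : profile G) i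
    (I : infoset G i) (x : node_in I) :
  (forall y, y = x) -> reach s (start G) (inl (val x)) != 0 -> bayes s x = 1.
Proof.
move=> eqx x0; rewrite /bayes (eq_bigl (pred1 x)) ?big_pred1_eq ?divff// => y.
by rewrite (eqx y) /= eqxx.
Qed.

(** * Sums over actions and labels for the nodes of Game 2 *)

Lemma sum_initiation {V : nmodType} (F : initiation -> V) :
  \sum_a F a = F Init + F NotInit.
Proof.
by rewrite -big_enum enumT Finite.enum.unlock !big_cons big_nil /= addr0.
Qed.

Lemma sum_collusion {V : nmodType} (F : collusion -> V) :
  \sum_a F a = F Collude + F NotCollude.
Proof.
by rewrite -big_enum enumT Finite.enum.unlock !big_cons big_nil /= addr0.
Qed.

Lemma sum_answer {V : nmodType} (F : answer -> V) :
  \sum_a F a = F AnsF + (F AnsR + F AnsOther).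
Proof.
by rewrite -big_enum enumT Finite.enum.unlock !big_cons big_nil /= addr0.
Qed.

(** Equality in [{i & infoset2 i}] transports along an opaque equality of
    players, so it does not compute on concrete information sets; the codes do. *)
Definition infoset2_code (u : {i & infoset2 i}) : nat :=
  match u with
  | existT LDR J => ldr_infoset_code J
  | existT FLR J => (2 + flr_infoset_code J)%N
  end.

(** LDR's answer leading to [v3], [v4] or [v5]; at the earlier nodes [AnsOther] is a dummy value. *)
Definition asked (x : decision2) : answer :=
  match x with v3 => AnsF | v4 => AnsR | _ => AnsOther end.

(** A table indexed by LDR's answer [q] and FLR's answer [a], so that the three nodes of [I22] are
    treated uniformly. *)
Definition outcome (q a : answer) : terminal2 :=
  match q, a with
  | AnsF, AnsF => v6 | AnsF, AnsR => v7 | AnsF, AnsOther => v8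
  | AnsR, AnsF => v9 | AnsR, AnsR => v10 | AnsR, AnsOther => v11
  | AnsOther, AnsF => v12 | AnsOther, AnsR => v13 | AnsOther, AnsOther => v14
  end.

(** * Nodes and payoffs of Game 2 *)

Section Game2.
Context {R : realType} (w c d b t z : R).
Local Notation G := (game2 w c d b t z).
Local Notation u := (payoff2 w c d b t z).
Implicit Types (s : profile G) (i : player).

(** Turns membership into an equation between numerals, which case analysis refutes at every wrong
    node. *)
Lemma node_in_code i (I : infoset2 i) (x : @node_in R G i I) :
  infoset2_code (info2 (val x)) = infoset2_code (existT _ i I).
Proof. by case: x => x /= /eqP ->. Qed.

Lemma node_in_I11 (x : @node_in R G LDR I11) :
  x = node_of w c d b t z (eqxx (info2 v0)).
Proof. by apply: val_inj; have := node_in_code _ _ x; case: (val x). Qed.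

Lemma node_in_I12 (x : @node_in R G LDR I12) :
  x = node_of w c d b t z (eqxx (info2 v2)).
Proof. by apply: val_inj; have := node_in_code _ _ x; case: (val x). Qed.

Lemma node_in_I21 (x : @node_in R G FLR I21) :
  x = node_of w c d b t z (eqxx (info2 v1)).
Proof. by apply: val_inj; have := node_in_code _ _ x; case: (val x). Qed.

Lemma card_decision2 : #|decision G| = 6%N.
Proof. by rewrite cardT enumT unlock. Qed.

Lemma node_payoff2 i s x : node_payoff i s (inl x) =
  \sum_(a : actions2 (tagged (info2 x)))
    s (tag (info2 x)) (tagged (info2 x)) a * node_payoff i s (child2 a).
Proof.
(* Moves between decision nodes increase the index, so 5 minus the index is a rank; it stays below
   the 6 decision nodes. *)
apply: (@node_payoff_decision R G (fun x => 5 - decision2_code x)%N).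
  by case=> -[] y //= [<-].
by case; rewrite /= card_decision2.
Qed.

Lemma node_payoff_I22 i s (x : @node_in R G FLR I22) :
  node_payoff i s (inl (val x)) =
  \sum_(a : answer) s FLR I22 a * u i (outcome (asked (val x)) a).
Proof.
have := node_in_code _ _ x; case: (val x) => //= _; rewrite node_payoff2;
by apply: eq_bigr => -[] _; rewrite /= node_payoff_terminal.
Qed.

Lemma node_payoff_v2 i s : node_payoff i s (inl v2) =
  \sum_(q : answer) s LDR I12 q *
    \sum_(a : answer) s FLR I22 a * u i (outcome q a).
Proof.
rewrite node_payoff2; apply: eq_bigr => -[] _; congr (_ * _).
- exact: (node_payoff_I22 i s (@node_of R w c d b t z FLR I22 v3 (eqxx _))).
- exact: (node_payoff_I22 i s (@node_of R w c d b t z FLR I22 v4 (eqxx _))).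
- exact: (node_payoff_I22 i s (@node_of R w c d b t z FLR I22 v5 (eqxx _))).
Qed.

Lemma node_payoff_v1 i s : node_payoff i s (inl v1) =
  \sum_(a : collusion) s FLR I21 a *
    (if a is Collude then node_payoff i s (inl v2) else w - c).
Proof.
rewrite node_payoff2; apply: eq_bigr => -[] _ //.
by rewrite /= node_payoff_terminal; case: i.
Qed.

Lemma node_payoff_v0 i s : node_payoff i s (inl v0) =
  \sum_(a : initiation) s LDR I11 a *
    (if a is Init then node_payoff i s (inl v1) else w - c).
Proof.
rewrite node_payoff2; apply: eq_bigr => -[] _ //.
by rewrite /= node_payoff_terminal; case: i.
Qed.

(** * Reach probabilities and Bayes' rule *)

Lemma reach_v1 s : reach s (start G) (inl v1) = s LDR I11 Init.
Proof.
rewrite /reach card_decision2 /= sum_initiation /=.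
by rewrite mulr1 mulr0 addr0.
Qed.

Lemma reach_v2 s :
  reach s (start G) (inl v2) = s LDR I11 Init * s FLR I21 Collude.
Proof.
rewrite /reach card_decision2 /= sum_initiation /= sum_collusion /=.
by rewrite mulr1 !mulr0 !addr0.
Qed.

Lemma reach_I22 s (x : @node_in R G FLR I22) : reach s (start G) (inl (val x)) =
  s LDR I11 Init * s FLR I21 Collude * s LDR I12 (asked (val x)).
Proof.
rewrite /reach card_decision2; have := node_in_code _ _ x.
case: (val x) => // _ /=; rewrite sum_initiation /= sum_collusion /=;
  rewrite !sum_answer /=;
by rewrite ?(mulr0, mulr1, addr0, add0r) mulrA.
Qed.

Lemma node_asked_subproof (q : answer) :
  info2 (match q with AnsF => v3 | AnsR => v4 | AnsOther => v5 end)
  == Tagged (fun i => infoset2 i) (I22 : infoset2 FLR).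
Proof. by case: q; apply: eqxx. Qed.

(** The inverse of [asked] on [I22], for indexing the denominator of Bayes' rule by answers. *)
Definition node_asked (q : answer) : @node_in R G FLR I22 :=
  node_of w c d b t z (node_asked_subproof q).

Lemma node_askedK q : asked (val (node_asked q)) = q.
Proof. by case: q. Qed.

Lemma asked_valK (x : @node_in R G FLR I22) : node_asked (asked (val x)) = x.
Proof.
by apply: val_inj; have := node_in_code _ _ x; case: (val x).
Qed.

(** The probability of reaching [v2] is a common nonzero factor and cancels; the remaining
    denominator is the total mass of LDR's mixture. *)
Lemma bayes_I22 s (x : @node_in R G FLR I22) : completely_mixed s ->
  bayes s x = s LDR I12 (asked (val x)).
Proof.
move=> s_gt0; have s0 i (I : infoset2 i) a : s i I a != 0.
  by rewrite gt_eqF// s_gt0.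
rewrite /bayes (reindex node_asked); last first.
  apply/onW_bij; exists (asked \o val); first exact: node_askedK.
  exact: asked_valK.
under eq_bigr do rewrite reach_I22 node_askedK.
rewrite reach_I22 -mulr_sumr sum_dist mulr1 mulrAC divff ?mul1r//.
by rewrite mulf_neq0// s0.
Qed.

Lemma bayes_I11 s (x : @node_in R G LDR I11) : bayes s x = 1.
Proof.
rewrite (node_in_I11 x); apply: bayes_singleton => [y|].
  exact: node_in_I11.
by rewrite /reach card_decision2 /= oner_neq0.
Qed.

Lemma bayes_I12 s (x : @node_in R G LDR I12) :
  completely_mixed s -> bayes s x = 1.
Proof.
move=> s_gt0; rewrite (node_in_I12 x).
apply: bayes_singleton => [y|]; first exact: node_in_I12.
by rewrite reach_v2 mulf_neq0// gt_eqF// s_gt0.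
Qed.

Lemma bayes_I21 s (x : @node_in R G FLR I21) :
  completely_mixed s -> bayes s x = 1.
Proof.
move=> s_gt0; rewrite (node_in_I21 x).
apply: bayes_singleton => [y|]; first exact: node_in_I21.
by rewrite reach_v1 gt_eqF// s_gt0.
Qed.

(** * Consistency: limits of Bayesian beliefs *)

Lemma consistent_I22 (a : assessment G) (x : @node_in R G FLR I22) :
  consistent a -> a.2 FLR I22 x = a.1 LDR I12 (asked (val x)).
Proof.
case=> s_ [mixed cvg_s cvg_b].
(* Along the approximating profiles the belief equals LDR's mixture at [v2], so both share one
   limit. *)
have := cvg_b FLR I22 x; under eq_fun do rewrite bayes_I22//.
by move=> /cvg_unique; apply=> //; exact: (cvg_s LDR I12).
Qed.

Lemma collusion_consistent : consistent (collusion_assessment w c d b t z).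
Proof.
exists (perturbation (collusion_profile w c d b t z)); split.
- exact: perturbation_mixed.
- exact: perturbation_cvg.
have mixed := perturbation_mixed (collusion_profile w c d b t z).
move=> [] [] x.
- under eq_fun do rewrite bayes_I11; rewrite (node_in_I11 x) /=.
  by rewrite point_massE eqxx; exact: cvg_cst.
- under eq_fun do rewrite bayes_I12//; rewrite (node_in_I12 x) /=.
  by rewrite point_massE eqxx; exact: cvg_cst.
- under eq_fun do rewrite bayes_I21//; rewrite (node_in_I21 x) /=.
  by rewrite point_massE eqxx; exact: cvg_cst.
(* Reading the belief through [asked] turns it into LDR's strategy at [I12], and the Bayesian
   beliefs into its perturbations. *)
rewrite (_ : collusion_beliefs w c d b t z FLR I22 x =
    point_mass R AnsR (asked (val x))).
  rewrite (_ : (fun k => _) = (fun k =>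
    perturbation (collusion_profile w c d b t z) k LDR I12 (asked (val x)))).
    exact: (perturbation_cvg (collusion_profile w c d b t z) LDR I12).
  by apply/funext => k; apply: bayes_I22.
rewrite /= !point_massE -(inj_eq (can_inj asked_valK)) /=.
by congr (_ == _)%:R; apply: val_inj.
Qed.

(** * Payoffs at the information sets *)

Lemma infoset_payoff_I22 s (bel : belief_system G) :
  infoset_payoff s (I22 : infoset G FLR) bel =
  \sum_(a : answer) s FLR I22 a *
    \sum_x bel FLR I22 x * u FLR (outcome (asked (val x)) a).
Proof.
rewrite /infoset_payoff; under eq_bigr do rewrite node_payoff_I22 mulr_sumr.
(* FLR's mixture is the same at all nodes of [I22], so swapping the sums gives an average over
   answers, as [dist_argmax] requires. *)
rewrite exchange_big; apply: eq_bigr => a _; rewrite mulr_sumr.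
by apply: eq_bigr => x _; rewrite mulrCA.
Qed.

Lemma infoset_payoff_I12 s bel :
  infoset_payoff s (I12 : infoset G LDR) bel = node_payoff LDR s (inl v2).
Proof. exact: infoset_payoff_singleton node_in_I12. Qed.

Lemma infoset_payoff_I21 s bel :
  infoset_payoff s (I21 : infoset G FLR) bel = node_payoff FLR s (inl v1).
Proof. exact: infoset_payoff_singleton node_in_I21. Qed.

Lemma infoset_payoff_I11 s bel :
  infoset_payoff s (I11 : infoset G LDR) bel = node_payoff LDR s (inl v0).
Proof. exact: infoset_payoff_singleton node_in_I11. Qed.

Lemma node_payoff_v2_collusion i s :
  s FLR I22 = point_mass R AnsR -> s LDR I12 = point_mass R AnsR ->
  node_payoff i s (inl v2) = u i v10.
Proof. by move=> s22 s12; rewrite node_payoff_v2 s12 s22 !sum_point_mass. Qed.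

Lemma node_payoff_v1_collusion i s :
  s FLR I22 = point_mass R AnsR -> s LDR I12 = point_mass R AnsR ->
  s FLR I21 = point_mass R Collude -> node_payoff i s (inl v1) = u i v10.
Proof.
move=> s22 s12 s21.
by rewrite node_payoff_v1 s21 sum_point_mass node_payoff_v2_collusion.
Qed.

(** * Rationality and uniqueness from three payoff comparisons *)

Hypothesis FLR_gt : forall q a, a != AnsR ->
  u FLR (outcome q a) < u FLR (outcome q AnsR).
Hypothesis LDR_gt : forall q, q != AnsR ->
  u LDR (outcome q AnsR) < u LDR (outcome AnsR AnsR).
Hypothesis u_gt : forall i, w - c < u i v10.

Lemma collusion_rational :
  sequentially_rational (collusion_assessment w c d b t z).
Proof.
have FLR_ge q a : u FLR (outcome q a) <= u FLR (outcome q AnsR).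
  by case: (eqVneq a AnsR) => [->//|/FLR_gt/ltW].
have LDR_ge q : u LDR (outcome q AnsR) <= u LDR v10.
  by case: (eqVneq q AnsR) => [->//|/LDR_gt/ltW].
have u_ge i := ltW (u_gt i).
move=> [] [] si /=.
- rewrite !infoset_payoff_I11 [leRHS]node_payoff_v0 sum_point_mass.
  rewrite node_payoff_v1_collusion// node_payoff_v0.
  apply: sum_dist_le => -[]//.
  (* The deviation may also change LDR's answer at [v2], so the bound continues down the tree
     against FLR's collusive play. *)
  rewrite node_payoff_v1 deviate_out// sum_point_mass node_payoff_v2.
  by apply: sum_dist_le => q; rewrite deviate_out// sum_point_mass.
- rewrite !infoset_payoff_I12 [leRHS]node_payoff_v2_collusion// node_payoff_v2.
  by apply: sum_dist_le => q; rewrite deviate_out// sum_point_mass.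
- rewrite !infoset_payoff_I21 [leRHS]node_payoff_v1_collusion// node_payoff_v1.
  apply: sum_dist_le => -[]//.
  rewrite node_payoff_v2 deviate_out// sum_point_mass.
  by apply: sum_dist_le => a; apply: FLR_ge.
rewrite !infoset_payoff_I22 sum_point_mass; apply: sum_dist_le => a.
by apply: ler_sum => x _; rewrite ler_wpM2l ?dist_ge0.
Qed.

Lemma equilibrium_unique (e : assessment G) :
  sequential_equilibrium e -> collusion_assessment w c d b t z = e.
Proof.
case: e => s bel [rat /consistent_I22 bel22]; rewrite /= in bel22.
have s22 : s FLR I22 = point_mass R AnsR.
  have := rat FLR I22 (collusion_profile w c d b t z FLR).
  rewrite /= !infoset_payoff_I22 deviate_in sum_point_mass.
  (* Strict dominance at each node survives averaging over any belief. *)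
  apply: dist_argmax => a aR; apply: sum_dist_lt => x.
  exact: FLR_gt.
have s12 : s LDR I12 = point_mass R AnsR.
  have := rat LDR I12 (collusion_profile w c d b t z LDR).
  rewrite /= !infoset_payoff_I12 !node_payoff_v2 deviate_in sum_point_mass.
  rewrite deviate_out// s22; apply: dist_argmax => q qR.
  by rewrite !sum_point_mass LDR_gt.
have s21 : s FLR I21 = point_mass R Collude.
  have := rat FLR I21 (collusion_profile w c d b t z FLR).
  rewrite /= !infoset_payoff_I21.
  rewrite node_payoff_v1_collusion ?deviate_in ?deviate_out//.
  rewrite node_payoff_v1 node_payoff_v2_collusion//.
  (* The values of FLR's two choices once the play after [Collude] is known. *)
  pose f a := if a is Collude then u FLR v10 else w - c.
  by apply: (dist_argmax (s FLR I21) f Collude) => -[]// _; apply: u_gt.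
have s11 : s LDR I11 = point_mass R Init.
  have := rat LDR I11 (collusion_profile w c d b t z LDR).
  rewrite /= !infoset_payoff_I11 !node_payoff_v0 deviate_in sum_point_mass.
  rewrite !node_payoff_v1_collusion// ?deviate_in// ?deviate_out//.
  pose f a := if a is Init then u LDR v10 else w - c.
  by apply: (dist_argmax (s LDR I11) f Init) => -[]// _; apply: u_gt.
congr pair; apply: functional_extensionality_dep => -[];
  apply: functional_extensionality_dep => -[] //=; symmetry.
- exact: dist_singleton node_in_I11.
- exact: dist_singleton node_in_I12.
- exact: dist_singleton node_in_I21.
(* Consistency equates the belief in [v4] with LDR's probability of [r], which is 1. *)
by apply: dist_point_mass; rewrite bel22 s12 point_massE.
Qed.

End Game2.

Theorem lemma6p1 (R : realType) (w c d ch b t z : R)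
  (hw : 0 <= w) (hc : 0 <= c) (hd : 0 <= d) (hch : 0 <= ch)
  (hb : 0 <= b) (ht : 0 <= t)
  (hwc : c <= w) (hch2w : 2 * w < ch)
  (hz : z = w - c + d - ch)
  (hdc : c + ch < d) (hbc : b < c) (htz : z + d - b < t) :
  unique (@sequential_equilibrium R (game2 w c d b t z))
         (collusion_assessment w c d b t z).
Proof.
(* The bound on [t] says exactly that [r] beats [f(x)] at [v5]. As [d > c + ch] gives [z > w], it
   also yields [t + b - d > z > w >= w - c] at [v3], and [z - t < b - d < w + b] at [v4]. *)
have FLR_gt q a : a != AnsR -> payoff2 w c d b t z FLR (outcome q a) <
    payoff2 w c d b t z FLR (outcome q AnsR).
  by case: q; case: a => //= _; lra.
(* For [f(x)] the bound on [t] gives [z - t < b - d < 0 <= w], using [b < c < d]. *)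
have LDR_gt q : q != AnsR -> payoff2 w c d b t z LDR (outcome q AnsR) <
    payoff2 w c d b t z LDR (outcome AnsR AnsR).
  by case: q => //= _; lra.
(* For LDR this is [b < c]; for FLR it follows from [0 <= b < c]. *)
have collude_gt i : w - c < payoff2 w c d b t z i v10 by case: i => /=; lra.
split; last by move=> e; apply: equilibrium_unique.
split; last exact: collusion_consistent.
exact: collusion_rational.
Qed.
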